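(* Let $\mathbb{K}$ be an algebraically closed field of characteristic not $2$ and $d\ge 0$ an integer. Each parameter array of diameter $d$ over $\mathbb{K}$ belonging to one of Terwilliger's seven $q$-families (listed in the context: $q$-Racah, $q$-Hahn, dual $q$-Hahn, $q$-Krawtchouk, dual $q$-Krawtchouk, quantum $q$-Krawtchouk, affine $q$-Krawtchouk) can be transformed by an affine transformation $$\theta_i\mapsto t\theta_i+c,\quad \theta_i^*\mapsto t^*\theta_i^*+c^*,\quad \varphi_i\mapsto tt^*\varphi_i,\quad \phi_i\mapsto tt^*\phi_i\qquad(c,c^*,t,t^*\in\mathbb{K},\ t,t^*\ne0)$$ to the following form, according to its family ($0\le i\le d$ for $\theta_i,\theta_i^*$; $1\le i\le d$ for $\varphi_i,\phi_i$). The scalar $q$ in these forms need not be equal to the scalar $q$ of the family. - $q$-Racah: $\theta_i=sq^{d-2i}+\frac{q^{2i-d}}{s}$, $\theta_i^*=s^*q^{d-2i}+\frac{q^{2i-d}}{s^*}$, $\varphi_i=\frac{q^{2d+2-4i}}{ss^*r}(1-q^{2i})(1-q^{2i-2d-2})(ss^*-rq^{2i-d-1})(ss^*r-q^{2i-d-1})$, $\phi_i=\frac{q^{2d+2-4i}}{ss^*r}(1-q^{2i})(1-q^{2i-2d-2})(s^*r-sq^{2i-d-1})(s^*-srq^{2i-d-1})$. - $q$-Hahn: $\theta_i=rq^{d-2i}$, $\theta_i^*=s^*q^{d-2i}+\frac{q^{2i-d}}{s^*}$, $\varphi_i=\frac{q^{2d+2-4i}}{r}(1-q^{2i})(1-q^{2i-2d-2})(s^*r^2-q^{2i-d-1})$,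 $\phi_i=-\frac{q^{d+1-2i}}{rs^*}(1-q^{2i})(1-q^{2i-2d-2})(s^*-r^2q^{2i-d-1})$. - Dual $q$-Hahn: $\theta_i=sq^{d-2i}+\frac{q^{2i-d}}{s}$, $\theta_i^*=rq^{d-2i}$, $\varphi_i=\frac{q^{2d+2-4i}}{r}(1-q^{2i})(1-q^{2i-2d-2})(sr^2-q^{2i-d-1})$, $\phi_i=\frac{q^{2d+2-4i}}{rs}(1-q^{2i})(1-q^{2i-2d-2})(r^2-sq^{2i-d-1})$. - $q$-Krawtchouk: $\theta_i=q^{d-2i}$, $\theta_i^*=s^*q^{d-2i}+\frac{q^{2i-d}}{s^*}$, $\varphi_i=s^*q^{2d+2-4i}(1-q^{2i})(1-q^{2i-2d-2})$, $\phi_i=\frac1{s^*}(1-q^{2i})(1-q^{2i-2d-2})$. - Dual $q$-Krawtchouk: $\theta_i=sq^{d-2i}+\frac{q^{2i-d}}{s}$, $\theta_i^*=q^{d-2i}$, $\varphi_i=s\,q^{2d+2-4i}(1-q^{2i})(1-q^{2i-2d-2})$, $\phi_i=\frac{q^{2d+2-4i}}{s}(1-q^{2i})(1-q^{2i-2d-2})$. - Quantum $q$-Krawtchouk: $\theta_i=rq^{2i-d}$, $\theta_i^*=rq^{d-2i}$, $\varphi_i=-\frac{q^{d+1-2i}}{r}(1-q^{2i})(1-q^{2i-2d-2})$, $\phi_i=\frac{q^{2d+2-4i}}{r}(1-q^{2i})(1-q^{2i-2d-2})(r^3-q^{2i-d-1})$. - Affine $q$-Krawtchouk: $\theta_i=rq^{d-2i}$,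 $\theta_i^*=rq^{d-2i}$, $\varphi_i=\frac{q^{2d+2-4i}}{r}(1-q^{2i})(1-q^{2i-2d-2})(r^3-q^{2i-d-1})$, $\phi_i=-\frac{q^{d+1-2i}}{r}(1-q^{2i})(1-q^{2i-2d-2})$. In each case, $q,s,s^*,r$ (those that occur) are nonzero scalars in $\mathbb{K}$ such that $\theta_i\ne\theta_j$, $\theta_i^*\ne\theta_j^*$ for $0\le i<j\le d$, and $\varphi_i\ne0$, $\phi_i\ne0$ for $1\le i\le d$.
   Context: A parameter array over $\mathbb{K}$ of diameter $d$ is a sequence $(\theta_0,\ldots,\theta_d;\theta_0^*,\ldots,\theta_d^*;\varphi_1,\ldots,\varphi_d;\phi_1,\ldots,\phi_d)$ of scalars in $\mathbb{K}$ such that: PA1. $\theta_i\neq\theta_j$, $\theta_i^*\ne\theta_j^*$ for $i\neq j$, $0\le i,j\le d$. PA2. $\varphi_i\ne0$, $\phi_i\ne0$ for $1\le i\le d$. PA3. $\varphi_i=\phi_1\sum_{j=0}^{i-1}\frac{\theta_j-\theta_{d-j}}{\theta_0-\theta_d}+(\theta_i^*-\theta_0^* )(\theta_{i-1}-\theta_d)$ for $1\le i\le d$. PA4. $\phi_i=\varphi_1\sum_{j=0}^{i-1}\frac{\theta_j-\theta_{d-j}}{\theta_0-\theta_d}+(\theta_i^*-\theta_0^* )(\theta_{d-i+1}-\theta_0)$ for $1\le i\le d$. PA5. $\frac{\theta_{i-2}-\theta_{i+1}}{\theta_{i-1}-\theta_i}$ and $\frac{\theta^*_{i-2}-\theta^*_{i+1}}{\theta^*_{i-1}-\theta^*_i}$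 are equal and independent of $i$ for $2\le i\le d-1$. Terwilliger's $q$-families: parameter arrays of the following forms, where $\theta_0,\theta_0^*\in\mathbb{K}$ are arbitrary and the other occurring parameters $h,h^*,q,s,s^*,r,r_1,r_2\in\mathbb{K}$ are nonzero. Write $P_i=(1-q^i)(1-q^{i-d-1})$. - $q$-Racah: $\theta_i=\theta_0+h(1-q^i)(1-sq^{i+1})q^{-i}$, $\theta_i^*=\theta_0^*+h^*(1-q^i)(1-s^*q^{i+1})q^{-i}$, $\varphi_i=hh^*q^{1-2i}P_i(1-r_1q^i)(1-r_2q^i)$, $\phi_i=hh^*q^{1-2i}P_i(r_1-s^*q^i)(r_2-s^*q^i)/s^*$, with $r_1r_2=ss^*q^{d+1}$. - $q$-Hahn: $\theta_i=\theta_0+h(1-q^i)q^{-i}$, $\theta_i^*=\theta_0^*+h^*(1-q^i)(1-s^*q^{i+1})q^{-i}$, $\varphi_i=hh^*q^{1-2i}P_i(1-rq^i)$, $\phi_i=-hh^*q^{1-i}P_i(r-s^*q^i)$. - Dual $q$-Hahn: $\theta_i=\theta_0+h(1-q^i)(1-sq^{i+1})q^{-i}$, $\theta_i^*=\theta_0^*+h^*(1-q^i)q^{-i}$, $\varphi_i=hh^*q^{1-2i}P_i(1-rq^i)$, $\phi_i=hh^*q^{d+2-2i}P_i(s-rq^{i-d-1})$. - $q$-Krawtchouk: $\theta_i=\theta_0+h(1-q^i)q^{-i}$, $\theta_i^*=\theta_0^*+h^*(1-q^i)(1-s^*q^{i+1})q^{-i}$, $\varphi_i=hh^*q^{1-2i}P_i$,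 $\phi_i=hh^*s^*qP_i$. - Dual $q$-Krawtchouk: $\theta_i=\theta_0+h(1-q^i)(1-sq^{i+1})q^{-i}$, $\theta_i^*=\theta_0^*+h^*(1-q^i)q^{-i}$, $\varphi_i=hh^*q^{1-2i}P_i$, $\phi_i=hh^*sq^{d+2-2i}P_i$. - Quantum $q$-Krawtchouk: $\theta_i=\theta_0-sq(1-q^i)$, $\theta_i^*=\theta_0^*+h^*(1-q^i)q^{-i}$, $\varphi_i=-rh^*q^{1-i}P_i$, $\phi_i=h^*q^{d+2-2i}P_i(s-rq^{i-d-1})$. - Affine $q$-Krawtchouk: $\theta_i=\theta_0+h(1-q^i)q^{-i}$, $\theta_i^*=\theta_0^*+h^*(1-q^i)q^{-i}$, $\varphi_i=hh^*q^{1-2i}P_i(1-rq^i)$, $\phi_i=-hh^*rq^{1-i}P_i$. *)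

(* Defs.v *)
From HB Require Import structures.
From mathcomp Require Import all_boot all_order all_algebra.

Set Implicit Arguments.
Unset Strict Implicit.
Unset Printing Implicit Defensive.

Import GRing.Theory.
Local Open Scope ring_scope.

(* The scalars theta_i, theta*_i, varphi_i, phi_i are stored in functions on
   nat.  In diameter d only theta_i, theta*_i with 0 <= i <= d and varphi_i,
   phi_i with 1 <= i <= d are meaningful; every predicate below constrains
   only those entries. *)
Record scalar_array (K : Type) := ScalarArray {
  theta : nat -> K;
  thetas : nat -> K;
  varphi : nat -> K;
  phi : nat -> K
}.

Section Arrays.

Variables (K : fieldType) (d : nat).
Implicit Type p : scalar_array K.

Definition PA1 p : Prop :=
  forall i j : nat, (i <= d)%N -> (j <= d)%N -> i <> j ->
    theta p i != theta p j /\ thetas p i != thetas p j.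

Definition PA2 p : Prop :=
  forall i : nat, (1 <= i <= d)%N -> varphi p i != 0 /\ phi p i != 0.

Definition vartheta p (i : nat) : K :=
  \sum_(0 <= j < i) (theta p j - theta p (d - j)%N) / (theta p 0 - theta p d).

Definition PA3 p : Prop :=
  forall i : nat, (1 <= i <= d)%N ->
    varphi p i = phi p 1 * vartheta p i
      + (thetas p i - thetas p 0) * (theta p (i - 1)%N - theta p d).

Definition PA4 p : Prop :=
  forall i : nat, (1 <= i <= d)%N ->
    phi p i = varphi p 1 * vartheta p i
      + (thetas p i - thetas p 0) * (theta p (d - i + 1)%N - theta p 0).

Definition PA5 p : Prop :=
  exists b : K, forall i : nat, (2 <= i <= d - 1)%N ->
    (theta p (i - 2)%N - theta p (i + 1)%N)
      / (theta p (i - 1)%N - theta p i) = b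
    /\ (thetas p (i - 2)%N - thetas p (i + 1)%N)
      / (thetas p (i - 1)%N - thetas p i) = b.

Definition parameter_array p : Prop :=
  [/\ PA1 p, PA2 p, PA3 p, PA4 p & PA5 p].

Definition affine_transform (t c ts cs : K) p : scalar_array K :=
  {| theta := fun i => t * theta p i + c;
     thetas := fun i => ts * thetas p i + cs;
     varphi := fun i => t * ts * varphi p i;
     phi := fun i => t * ts * phi p i |}.

Definition has_entries p (f fs g h : nat -> K) : Prop :=
  (forall i : nat, (i <= d)%N -> theta p i = f i /\ thetas p i = fs i) /\
  (forall i : nat, (1 <= i <= d)%N -> varphi p i = g i /\ phi p i = h i).

End Arrays.

Inductive q_family : Type :=
  | QRacah | QHahn | DualQHahn | QKrawtchouk | DualQKrawtchouk
  | QuantumQKrawtchouk | AffineQKrawtchouk.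

Section Families.

Variables (K : fieldType) (d : nat).
Implicit Types (p : scalar_array K) (q : K) (i : nat).

Definition Pfac q i : K := (1 - q ^+ i) * (1 - q ^ (i%:Z - d%:Z - 1)).

(* The scalars theta_0 and theta*_0 occurring in the formulas are the 0-th
   entries of the array itself. *)
Definition in_family (F : q_family) p : Prop :=
  match F with
  | QRacah => exists h hs q s ss r1 r2 : K,
      [/\ [/\ h != 0, hs != 0 & q != 0],
          [/\ s != 0, ss != 0, r1 != 0 & r2 != 0],
          r1 * r2 = s * ss * q ^+ d.+1 &
        has_entries d p
          (fun i => theta p 0
             + h * (1 - q ^+ i) * (1 - s * q ^+ i.+1) * q ^- i)
          (fun i => thetas p 0
             + hs * (1 - q ^+ i) * (1 - ss * q ^+ i.+1) * q ^- i)
          (fun i => h * hs * q ^ (1 - 2 * i%:Z) * Pfac q i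
             * (1 - r1 * q ^+ i) * (1 - r2 * q ^+ i))
          (fun i => h * hs * q ^ (1 - 2 * i%:Z) * Pfac q i
             * (r1 - ss * q ^+ i) * (r2 - ss * q ^+ i) / ss)]
  | QHahn => exists h hs q ss r : K,
      [/\ [/\ h != 0, hs != 0 & q != 0],
          ss != 0, r != 0 &
        has_entries d p
          (fun i => theta p 0 + h * (1 - q ^+ i) * q ^- i)
          (fun i => thetas p 0
             + hs * (1 - q ^+ i) * (1 - ss * q ^+ i.+1) * q ^- i)
          (fun i => h * hs * q ^ (1 - 2 * i%:Z) * Pfac q i * (1 - r * q ^+ i))
          (fun i => - (h * hs * q ^ (1 - i%:Z) * Pfac q i
             * (r - ss * q ^+ i)))]
  | DualQHahn => exists h hs q s r : K,
      [/\ [/\ h != 0, hs != 0 & q != 0],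
          s != 0, r != 0 &
        has_entries d p
          (fun i => theta p 0
             + h * (1 - q ^+ i) * (1 - s * q ^+ i.+1) * q ^- i)
          (fun i => thetas p 0 + hs * (1 - q ^+ i) * q ^- i)
          (fun i => h * hs * q ^ (1 - 2 * i%:Z) * Pfac q i * (1 - r * q ^+ i))
          (fun i => h * hs * q ^ (d%:Z + 2 - 2 * i%:Z) * Pfac q i
             * (s - r * q ^ (i%:Z - d%:Z - 1)))]
  | QKrawtchouk => exists h hs q ss : K,
      [/\ [/\ h != 0, hs != 0 & q != 0],
          ss != 0 &
        has_entries d p
          (fun i => theta p 0 + h * (1 - q ^+ i) * q ^- i)
          (fun i => thetas p 0
             + hs * (1 - q ^+ i) * (1 - ss * q ^+ i.+1) * q ^- i)
          (fun i => h * hs * q ^ (1 - 2 * i%:Z) * Pfac q i)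
          (fun i => h * hs * ss * q * Pfac q i)]
  | DualQKrawtchouk => exists h hs q s : K,
      [/\ [/\ h != 0, hs != 0 & q != 0],
          s != 0 &
        has_entries d p
          (fun i => theta p 0
             + h * (1 - q ^+ i) * (1 - s * q ^+ i.+1) * q ^- i)
          (fun i => thetas p 0 + hs * (1 - q ^+ i) * q ^- i)
          (fun i => h * hs * q ^ (1 - 2 * i%:Z) * Pfac q i)
          (fun i => h * hs * s * q ^ (d%:Z + 2 - 2 * i%:Z) * Pfac q i)]
  | QuantumQKrawtchouk => exists hs q s r : K,
      [/\ hs != 0, q != 0, s != 0, r != 0 &
        has_entries d p
          (fun i => theta p 0 - s * q * (1 - q ^+ i))
          (fun i => thetas p 0 + hs * (1 - q ^+ i) * q ^- i)
          (fun i => - (r * hs * q ^ (1 - i%:Z) * Pfac q i))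
          (fun i => hs * q ^ (d%:Z + 2 - 2 * i%:Z) * Pfac q i
             * (s - r * q ^ (i%:Z - d%:Z - 1)))]
  | AffineQKrawtchouk => exists h hs q r : K,
      [/\ h != 0, hs != 0, q != 0, r != 0 &
        has_entries d p
          (fun i => theta p 0 + h * (1 - q ^+ i) * q ^- i)
          (fun i => thetas p 0 + hs * (1 - q ^+ i) * q ^- i)
          (fun i => h * hs * q ^ (1 - 2 * i%:Z) * Pfac q i * (1 - r * q ^+ i))
          (fun i => - (h * hs * r * q ^ (1 - i%:Z) * Pfac q i))]
  end.

Definition Qfac q i : K :=
  (1 - q ^+ (2 * i)) * (1 - q ^ (2 * i%:Z - 2 * d%:Z - 2)).

Definition normal_form (F : q_family) p : Prop :=
  match F with
  | QRacah => exists q s ss r : K,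
      [/\ q != 0, s != 0, ss != 0, r != 0 &
        has_entries d p
          (fun i => s * q ^ (d%:Z - 2 * i%:Z) + q ^ (2 * i%:Z - d%:Z) / s)
          (fun i => ss * q ^ (d%:Z - 2 * i%:Z) + q ^ (2 * i%:Z - d%:Z) / ss)
          (fun i => q ^ (2 * d%:Z + 2 - 4 * i%:Z) / (s * ss * r) * Qfac q i
             * (s * ss - r * q ^ (2 * i%:Z - d%:Z - 1))
             * (s * ss * r - q ^ (2 * i%:Z - d%:Z - 1)))
          (fun i => q ^ (2 * d%:Z + 2 - 4 * i%:Z) / (s * ss * r) * Qfac q i
             * (ss * r - s * q ^ (2 * i%:Z - d%:Z - 1))
             * (ss - s * r * q ^ (2 * i%:Z - d%:Z - 1)))]
  | QHahn => exists q ss r : K,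
      [/\ q != 0, ss != 0, r != 0 &
        has_entries d p
          (fun i => r * q ^ (d%:Z - 2 * i%:Z))
          (fun i => ss * q ^ (d%:Z - 2 * i%:Z) + q ^ (2 * i%:Z - d%:Z) / ss)
          (fun i => q ^ (2 * d%:Z + 2 - 4 * i%:Z) / r * Qfac q i
             * (ss * r ^+ 2 - q ^ (2 * i%:Z - d%:Z - 1)))
          (fun i => - (q ^ (d%:Z + 1 - 2 * i%:Z) / (r * ss) * Qfac q i
             * (ss - r ^+ 2 * q ^ (2 * i%:Z - d%:Z - 1))))]
  | DualQHahn => exists q s r : K,
      [/\ q != 0, s != 0, r != 0 &
        has_entries d p
          (fun i => s * q ^ (d%:Z - 2 * i%:Z) + q ^ (2 * i%:Z - d%:Z) / s)
          (fun i => r * q ^ (d%:Z - 2 * i%:Z))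
          (fun i => q ^ (2 * d%:Z + 2 - 4 * i%:Z) / r * Qfac q i
             * (s * r ^+ 2 - q ^ (2 * i%:Z - d%:Z - 1)))
          (fun i => q ^ (2 * d%:Z + 2 - 4 * i%:Z) / (r * s) * Qfac q i
             * (r ^+ 2 - s * q ^ (2 * i%:Z - d%:Z - 1)))]
  | QKrawtchouk => exists q ss : K,
      [/\ q != 0, ss != 0 &
        has_entries d p
          (fun i => q ^ (d%:Z - 2 * i%:Z))
          (fun i => ss * q ^ (d%:Z - 2 * i%:Z) + q ^ (2 * i%:Z - d%:Z) / ss)
          (fun i => ss * q ^ (2 * d%:Z + 2 - 4 * i%:Z) * Qfac q i)
          (fun i => ss^-1 * Qfac q i)]
  | DualQKrawtchouk => exists q s : K,
      [/\ q != 0, s != 0 &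
        has_entries d p
          (fun i => s * q ^ (d%:Z - 2 * i%:Z) + q ^ (2 * i%:Z - d%:Z) / s)
          (fun i => q ^ (d%:Z - 2 * i%:Z))
          (fun i => s * q ^ (2 * d%:Z + 2 - 4 * i%:Z) * Qfac q i)
          (fun i => q ^ (2 * d%:Z + 2 - 4 * i%:Z) / s * Qfac q i)]
  | QuantumQKrawtchouk => exists q r : K,
      [/\ q != 0, r != 0 &
        has_entries d p
          (fun i => r * q ^ (2 * i%:Z - d%:Z))
          (fun i => r * q ^ (d%:Z - 2 * i%:Z))
          (fun i => - (q ^ (d%:Z + 1 - 2 * i%:Z) / r * Qfac q i))
          (fun i => q ^ (2 * d%:Z + 2 - 4 * i%:Z) / r * Qfac q i
             * (r ^+ 3 - q ^ (2 * i%:Z - d%:Z - 1)))]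
  | AffineQKrawtchouk => exists q r : K,
      [/\ q != 0, r != 0 &
        has_entries d p
          (fun i => r * q ^ (d%:Z - 2 * i%:Z))
          (fun i => r * q ^ (d%:Z - 2 * i%:Z))
          (fun i => q ^ (2 * d%:Z + 2 - 4 * i%:Z) / r * Qfac q i
             * (r ^+ 3 - q ^ (2 * i%:Z - d%:Z - 1)))
          (fun i => - (q ^ (d%:Z + 1 - 2 * i%:Z) / r * Qfac q i))]
  end.

End Families.

(* Main.v *)
Require Import Defs.
From mathcomp Require Import all_boot all_order all_algebra.
From mathcomp Require Import ring.

Import GRing.Theory.
Local Open Scope ring_scope.

(** Write the family's [q] as [x^2] and put [D = x^d]; the new scalar [q] is
[x].  Up to an additive constant, [theta_i] is [h x^(-2i) + h s x^2 x^(2i)] or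
one of these two terms alone.  With both terms, the scaling [t] such that
[t h = S D] yields [S x^(d-2i) + x^(2i-d)/S] as soon as [S^2 s x^2 D^2 = 1];
likewise for [theta*_i].  The parameter [r] of the normal form is found by
comparing the factors linear in [x^(2i)] on both sides, which requires a square
root for the two Hahn families, a cube root for the quantum and affine
Krawtchouk families, and no root for Racah. *)

(** * Roots in an algebraically closed field *)

Lemma closed_nth_root_neq0 (K : closedFieldType) (n : nat) (z : K) :
  (0 < n)%N -> z != 0 -> exists2 y : K, y != 0 & z = y ^+ n.
Proof.
move=> n_gt0 z_neq0.
(* Only the constant coefficient is nonzero, so the monic equation solved is [y ^+ n = z]. *)
have [y yE] := solve_monicpoly (fun i => if i == 0%N then z else 0) n_gt0.
have {}yE : z = y ^+ n.
  rewrite yE; case: n n_gt0 {yE} => // n _.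
  by rewrite big_ord_recl expr0 mulr1 big1 ?addr0 // => i _; rewrite mul0r.
by exists y => //; move: z_neq0; rewrite yE expf_eq0 n_gt0.
Qed.

(** Take an [n]-th root of [(z * m)^-1]. In this shape a family parameter can be eliminated in
    favour of the new one by rewriting. *)
Lemma closed_inv_nth_root (K : closedFieldType) (n : nat) (m z : K) :
  (0 < n)%N -> m != 0 -> z != 0 -> exists2 y : K, y != 0 & z = (y ^+ n * m)^-1.
Proof.
move=> n_gt0 m0 z0.
have [|y y0 yE] := closed_nth_root_neq0 K n (z * m)^-1 n_gt0.
  by rewrite invr_eq0 mulf_neq0.
by exists y => //; rewrite -yE; field; rewrite z0 m0 oner_neq0.
Qed.

(** * Effect of affine transformations on arrays *)

Section AffineTransform.

Variables (K : fieldType) (d : nat) (t c ts cs : K).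
Hypotheses (t_neq0 : t != 0) (ts_neq0 : ts != 0).

Lemma PA1_affine p : PA1 d p -> PA1 d (affine_transform t c ts cs p).
Proof.
move=> hp i j id jd /(hp i j id jd)[] /=; rewrite !(inj_eq (addIr _)).
by rewrite !(inj_eq (mulfI _)).
Qed.

Lemma PA2_affine p : PA2 d p -> PA2 d (affine_transform t c ts cs p).
Proof. by move=> hp i /hp[vi fi] /=; rewrite !mulf_neq0. Qed.

(** Reduces a normal form to four identities of formulas. These hold for every natural [i], so the
    index bounds are left to [has_entries]. *)
Lemma has_entries_affine (p : scalar_array K)
    (f fs g e f' fs' g' e' : nat -> K) :
  has_entries d p f fs g e ->
  (forall i, t * f i + c = f' i) -> (forall i, ts * fs i + cs = fs' i) ->
  (forall i, t * ts * g i = g' i) -> (forall i, t * ts * e i = e' i) ->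
  has_entries d (affine_transform t c ts cs p) f' fs' g' e'.
Proof.
move=> [H1 H2] Hf Hfs Hg He; split=> i.
  by move=> /H1[/= -> ->].
by move=> /H2[/= -> ->].
Qed.

End AffineTransform.

(** * Powers as Laurent monomials *)

Section Powers.

Variables (K : fieldType) (x : K).
Hypothesis x_neq0 : x != 0.

Lemma exprz_monomial (d i : nat) (a b c : int) :
  x ^ (a * d%:Z + b * i%:Z + c) = (x ^+ d) ^ a * (x ^+ i) ^ b * x ^ c.
Proof.
by rewrite !expfzDr // !exprnP !exprz_exp (mulrC a) (mulrC b).
Qed.

(** A rewriting bundle for all powers in the families, with [q] equal to [x ^+ 2], and in the normal
    forms, with [q] equal to [x]. Afterwards only natural powers of [x ^+ d], [x ^+ i] and [x]
    remain. *)
Lemma powersE (d i : nat) :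
  (((x ^+ 2) ^+ i = (x ^+ i) ^+ 2) *
   ((x ^+ 2) ^+ i.+1 = (x ^+ i) ^+ 2 * x ^+ 2) *
   ((x ^+ 2) ^+ d.+1 = (x ^+ d) ^+ 2 * x ^+ 2) *
   (x ^+ (2 * i) = (x ^+ i) ^+ 2)) *
  (((x ^+ 2) ^ (1 - 2 * i%:Z) = x ^+ 2 / (x ^+ i) ^+ 4) *
   ((x ^+ 2) ^ (1 - i%:Z) = x ^+ 2 / (x ^+ i) ^+ 2) *
   ((x ^+ 2) ^ (i%:Z - d%:Z - 1) = (x ^+ i) ^+ 2 / ((x ^+ d) ^+ 2 * x ^+ 2)) *
   ((x ^+ 2) ^ (d%:Z + 2 - 2 * i%:Z)
      = (x ^+ d) ^+ 2 * x ^+ 4 / (x ^+ i) ^+ 4)) *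
  ((x ^ (d%:Z - 2 * i%:Z) = x ^+ d / (x ^+ i) ^+ 2) *
   (x ^ (2 * i%:Z - d%:Z) = (x ^+ i) ^+ 2 / x ^+ d) *
   (x ^ (d%:Z + 1 - 2 * i%:Z) = x ^+ d * x / (x ^+ i) ^+ 2) *
   (x ^ (2 * i%:Z - d%:Z - 1) = (x ^+ i) ^+ 2 / (x ^+ d * x)) *
   (x ^ (2 * i%:Z - 2 * d%:Z - 2) = (x ^+ i) ^+ 2 / ((x ^+ d) ^+ 2 * x ^+ 2)) *
   (x ^ (2 * d%:Z + 2 - 4 * i%:Z)
      = (x ^+ d) ^+ 2 * x ^+ 2 / (x ^+ i) ^+ 4)).
Proof.
have sq (e : int) : (x ^+ 2) ^ e = x ^ (2 * e) by rewrite exprnP exprz_exp.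
(* The exponent enters through an equation, so that its coefficients can be supplied by hand and
   checked by [ring]. *)
have mon a b c e : e = a * d%:Z + b * i%:Z + c ->
    x ^ e = (x ^+ d) ^ a * (x ^+ i) ^ b * x ^ c.
  by move=> ->; exact: exprz_monomial.
have D_neq0 : x ^+ d != 0 by rewrite expf_neq0.
do !split.
- by rewrite exprAC.
- by rewrite exprSr exprAC.
- by rewrite exprSr exprAC.
- by rewrite mulnC exprM.
- by rewrite sq (@mon 0 (- 4%:Z) 2); [|ring]; rewrite expr0z mul1r mulrC.
- by rewrite sq (@mon 0 (- 2%:Z) 2); [|ring]; rewrite expr0z mul1r mulrC.
- by rewrite sq (@mon (- 2%:Z) 2 (- 2%:Z)); [|ring];
     rewrite -!exprnN -!exprnP; field; rewrite D_neq0 x_neq0 ?oner_neq0.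
- by rewrite sq (@mon 2 (- 4%:Z) 4); [|ring];
     rewrite -!exprnN -!exprnP mulrAC.
- by rewrite (@mon 1 (- 2%:Z) 0); [|ring]; rewrite mulr1.
- by rewrite (@mon (- 1%:Z) 2 0); [|ring]; rewrite mulr1 mulrC.
- by rewrite (@mon 1 (- 2%:Z) 1); [|ring]; rewrite !expr1z mulrAC.
- by rewrite (@mon (- 1%:Z) 2 (- 1%:Z)); [|ring];
     rewrite -!exprnN -!exprnP; field; rewrite D_neq0 x_neq0 ?oner_neq0.
- by rewrite (@mon (- 2%:Z) 2 (- 2%:Z)); [|ring];
     rewrite -!exprnN -!exprnP; field; rewrite D_neq0 x_neq0 ?oner_neq0.
- by rewrite (@mon 2 (- 4%:Z) 2); [|ring];
     rewrite -!exprnN -!exprnP mulrAC.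
Qed.

End Powers.

(** * The seven families *)

Section Families.

Variables (K : closedFieldType) (d : nat) (p : scalar_array K).

Definition normalizable (F : q_family) : Prop :=
  exists t c ts cs : K,
    [/\ t != 0, ts != 0 & normal_form d F (affine_transform t c ts cs p)].

Ltac prove_entry x x0 D0 i :=
  have := expf_neq0 i x0;
  rewrite /Pfac /Qfac ?(@powersE _ x x0 d i);
  (* With [x ^+ d] and [x ^+ i] generalized to arbitrary nonzero scalars, the entry becomes an
     identity of rational functions. *)
  move: (x ^+ d) (x ^+ i) D0 => ? ? ? ?; field;
  do ?[apply/andP; split]; by [exact: oner_neq0 | assumption].

Lemma QRacah_normalizable : in_family d QRacah p ->
  normalizable QRacah.
Proof.
move=> [h [hs [q [s [ss [r1 [r2 [[h0 hs0 q0] [s0 ss0 r10 r20]]]]]]]]].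
have [x x0 ->] := closed_nth_root_neq0 K 2 q isT q0 => r12 H {q q0}.
have D0 : x ^+ d != 0 by rewrite expf_neq0.
have [S S0 sE] : exists2 S : K, S != 0 &
    s = (S ^+ 2 * (x ^+ 2 * (x ^+ d) ^+ 2))^-1.
  by apply: closed_inv_nth_root; rewrite ?mulf_neq0.
have [Ss Ss0 ssE] : exists2 Ss : K, Ss != 0 &
    ss = (Ss ^+ 2 * (x ^+ 2 * (x ^+ d) ^+ 2))^-1.
  by apply: closed_inv_nth_root; rewrite ?mulf_neq0.
(* The constraint on [r1 * r2] eliminates [r2]; matching the factor of [r1] below then matches that
   of [r2] as well. *)
have r2E : r2 = s * ss * (x ^+ 2) ^+ d.+1 / r1 by rewrite -r12; field.
clear r12 r20; subst r2 s ss.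
set s := (S ^+ 2 * _)^-1 in H *; set ss := (Ss ^+ 2 * _)^-1 in H *.
(* Expanding the product shows that the constant part of [theta_i] is
   [theta p 0 - h - h * s * x ^+ 2]; the translation cancels it. *)
exists (S * x ^+ d / h),
  (- (S * x ^+ d / h) * (theta p 0 - h - h * s * x ^+ 2)).
exists (Ss * x ^+ d / hs),
  (- (Ss * x ^+ d / hs) * (thetas p 0 - hs - hs * ss * x ^+ 2)).
split; rewrite ?mulf_neq0 ?invr_eq0 //.
(* This [r] makes [S * Ss - r * x ^ (2i-d-1)] equal to [S * Ss * (1 - r1 * x ^ (2i))]. *)
exists x, S, Ss, (r1 * S * Ss * x ^+ d * x); split; rewrite ?mulf_neq0 //.
rewrite {}/s {}/ss in H *.
apply: has_entries_affine H _ _ _ _ => i; prove_entry x x0 D0 i.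
Qed.

Lemma QHahn_normalizable : in_family d QHahn p ->
  normalizable QHahn.
Proof.
move=> [h [hs [q [ss [r [[h0 hs0 q0] ss0 r0]]]]]].
have [x x0 ->] := closed_nth_root_neq0 K 2 q isT q0 => H {q q0}.
have D0 : x ^+ d != 0 by rewrite expf_neq0.
have [Ss Ss0 ssE] : exists2 Ss : K, Ss != 0 &
    ss = (Ss ^+ 2 * (x ^+ 2 * (x ^+ d) ^+ 2))^-1.
  by apply: closed_inv_nth_root; rewrite ?mulf_neq0.
(* Chosen so that [Ss * R ^+ 2 - x ^ (2i-d-1)] is a multiple of [1 - r * x ^ (2i)]. The single-term
   sequence can be scaled freely, and [R] is also its new coefficient. *)
have [R R0 rE] : exists2 R : K, R != 0 &
    r = (R ^+ 2 * (Ss * x ^+ d * x))^-1.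
  by apply: closed_inv_nth_root; rewrite ?mulf_neq0.
exists (R * x ^+ d / h),
  (- (R * x ^+ d / h) * (theta p 0 - h)).
exists (Ss * x ^+ d / hs),
  (- (Ss * x ^+ d / hs) * (thetas p 0 - hs - hs * ss * x ^+ 2)).
split; rewrite ?mulf_neq0 ?invr_eq0 //.
exists x, Ss, R; split; rewrite ?mulf_neq0 //.
rewrite {}ssE {}rE in H *.
apply: has_entries_affine H _ _ _ _ => i; prove_entry x x0 D0 i.
Qed.

Lemma DualQHahn_normalizable : in_family d DualQHahn p ->
  normalizable DualQHahn.
Proof.
move=> [h [hs [q [s [r [[h0 hs0 q0] s0 r0]]]]]].
have [x x0 ->] := closed_nth_root_neq0 K 2 q isT q0 => H {q q0}.
have D0 : x ^+ d != 0 by rewrite expf_neq0.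
have [S S0 sE] : exists2 S : K, S != 0 &
    s = (S ^+ 2 * (x ^+ 2 * (x ^+ d) ^+ 2))^-1.
  by apply: closed_inv_nth_root; rewrite ?mulf_neq0.
have [R R0 rE] : exists2 R : K, R != 0 &
    r = (R ^+ 2 * (S * x ^+ d * x))^-1.
  by apply: closed_inv_nth_root; rewrite ?mulf_neq0.
exists (S * x ^+ d / h),
  (- (S * x ^+ d / h) * (theta p 0 - h - h * s * x ^+ 2)).
exists (R * x ^+ d / hs),
  (- (R * x ^+ d / hs) * (thetas p 0 - hs)).
split; rewrite ?mulf_neq0 ?invr_eq0 //.
exists x, S, R; split; rewrite ?mulf_neq0 //.
rewrite {}sE {}rE in H *.
apply: has_entries_affine H _ _ _ _ => i; prove_entry x x0 D0 i.
Qed.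

(** Neither [varphi] nor [phi] has a factor linear in [x ^ (2i)] beyond [Pfac], so the free scaling
    of [theta] is spent on making its coefficient 1. *)
Lemma QKrawtchouk_normalizable : in_family d QKrawtchouk p ->
  normalizable QKrawtchouk.
Proof.
move=> [h [hs [q [ss [[h0 hs0 q0] ss0]]]]].
have [x x0 ->] := closed_nth_root_neq0 K 2 q isT q0 => H {q q0}.
have D0 : x ^+ d != 0 by rewrite expf_neq0.
have [Ss Ss0 ssE] : exists2 Ss : K, Ss != 0 &
    ss = (Ss ^+ 2 * (x ^+ 2 * (x ^+ d) ^+ 2))^-1.
  by apply: closed_inv_nth_root; rewrite ?mulf_neq0.
exists (x ^+ d / h),
  (- (x ^+ d / h) * (theta p 0 - h)).
exists (Ss * x ^+ d / hs),
  (- (Ss * x ^+ d / hs) * (thetas p 0 - hs - hs * ss * x ^+ 2)).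
split; rewrite ?mulf_neq0 ?invr_eq0 //.
exists x, Ss; split; rewrite ?mulf_neq0 //.
rewrite {}ssE in H *.
apply: has_entries_affine H _ _ _ _ => i; prove_entry x x0 D0 i.
Qed.

Lemma DualQKrawtchouk_normalizable : in_family d DualQKrawtchouk p ->
  normalizable DualQKrawtchouk.
Proof.
move=> [h [hs [q [s [[h0 hs0 q0] s0]]]]].
have [x x0 ->] := closed_nth_root_neq0 K 2 q isT q0 => H {q q0}.
have D0 : x ^+ d != 0 by rewrite expf_neq0.
have [S S0 sE] : exists2 S : K, S != 0 &
    s = (S ^+ 2 * (x ^+ 2 * (x ^+ d) ^+ 2))^-1.
  by apply: closed_inv_nth_root; rewrite ?mulf_neq0.
exists (S * x ^+ d / h),
  (- (S * x ^+ d / h) * (theta p 0 - h - h * s * x ^+ 2)).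
exists (x ^+ d / hs),
  (- (x ^+ d / hs) * (thetas p 0 - hs)).
split; rewrite ?mulf_neq0 ?invr_eq0 //.
exists x, S; split; rewrite ?mulf_neq0 //.
rewrite {}sE in H *.
apply: has_entries_affine H _ _ _ _ => i; prove_entry x x0 D0 i.
Qed.

Lemma QuantumQKrawtchouk_normalizable : in_family d QuantumQKrawtchouk p ->
  normalizable QuantumQKrawtchouk.
Proof.
move=> [hs [q [s [r [hs0 q0 s0 r0]]]]].
have [x x0 ->] := closed_nth_root_neq0 K 2 q isT q0 => H {q q0}.
have D0 : x ^+ d != 0 by rewrite expf_neq0.
(* Here the linear factor sits in [phi]: [s - r * x ^ (2i-2d-2)] has to be proportional to
   [R ^+ 3 - x ^ (2i-d-1)]. *)
have [R R0 sE] : exists2 R : K, R != 0 &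
    s = R ^+ 3 * r / (x ^+ d * x).
  have [|R R0 RE] := closed_nth_root_neq0 K 3 (s * (x ^+ d * x) / r) isT.
    by rewrite !mulf_neq0 ?invr_eq0.
  by exists R => //; rewrite -RE; field; rewrite x0 D0 r0.
(* The nonconstant term of [theta_i] is [s * x ^+ 2 * x ^ (2i)], with increasing exponent, so it is
   scaled to [R * x ^ (2i-d)]. *)
exists (R / (x ^+ d * s * x ^+ 2)),
  (- (R / (x ^+ d * s * x ^+ 2)) * (theta p 0 - s * x ^+ 2)).
exists (R * x ^+ d / hs),
  (- (R * x ^+ d / hs) * (thetas p 0 - hs)).
split; rewrite ?mulf_neq0 ?invr_eq0 ?mulf_neq0 //.
exists x, R; split; rewrite ?mulf_neq0 //.
rewrite {}sE in H s0 *.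
apply: has_entries_affine H _ _ _ _ => i; prove_entry x x0 D0 i.
Qed.

Lemma AffineQKrawtchouk_normalizable : in_family d AffineQKrawtchouk p ->
  normalizable AffineQKrawtchouk.
Proof.
move=> [h [hs [q [r [h0 hs0 q0 r0]]]]].
have [x x0 ->] := closed_nth_root_neq0 K 2 q isT q0 => H {q q0}.
have D0 : x ^+ d != 0 by rewrite expf_neq0.
(* Both sequences receive the coefficient [R], which puts [R ^+ 2] in front of [1 - r * x ^ (2i)].
   The target [(R ^+ 3 - x ^ (2i-d-1)) / R] then forces a cube. *)
have [R R0 rE] : exists2 R : K, R != 0 &
    r = (R ^+ 3 * (x ^+ d * x))^-1.
  by apply: closed_inv_nth_root; rewrite ?mulf_neq0.
exists (R * x ^+ d / h),
  (- (R * x ^+ d / h) * (theta p 0 - h)).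
exists (R * x ^+ d / hs),
  (- (R * x ^+ d / hs) * (thetas p 0 - hs)).
split; rewrite ?mulf_neq0 ?invr_eq0 //.
exists x, R; split; rewrite ?mulf_neq0 //.
rewrite {}rE in H *.
apply: has_entries_affine H _ _ _ _ => i; prove_entry x x0 D0 i.
Qed.

End Families.

Theorem lemma6p1 (K : closedFieldType) (hchar : 2%N \notin [pchar K])
    (d : nat) (F : q_family) (p : scalar_array K)
    (hp : parameter_array d p) (hF : in_family d F p) :
  exists t c ts cs : K,
    [/\ t != 0, ts != 0,
        normal_form d F (affine_transform t c ts cs p),
        PA1 d (affine_transform t c ts cs p)
      & PA2 d (affine_transform t c ts cs p)].
Proof.
have [t [c [ts [cs [t0 ts0 nf]]]]] : normalizable K d p F.
  case: F hF; [ exact: QRacah_normalizable | exact: QHahn_normalizable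
    | exact: DualQHahn_normalizable | exact: QKrawtchouk_normalizable
    | exact: DualQKrawtchouk_normalizable
    | exact: QuantumQKrawtchouk_normalizable
    | exact: AffineQKrawtchouk_normalizable ].
(* Distinctness and nonvanishing are inherited from the given array, since both scalings are
   nonzero. *)
have [hp1 hp2 _ _ _] := hp.
by exists t, c, ts, cs; split=> //; [exact: PA1_affine | exact: PA2_affine].
Qed.
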